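(* Let $r_1=r_2=r_3=r>0$, and let $P_1,P_2,P_3$ be independent random points, each uniform on the circle of radius $r$ about $O$. Then $p_k=1/4$ for each $k\in\{1,2,3\}$ and $P(\text{obtuse})=3/4$.
   Context: $O$ is the origin of $\mathbb{R}^2$. For each $k$, $p_k$ is the probability that $P_1,P_2,P_3$ form a (non-degenerate) triangle whose interior angle at $P_k$ exceeds $\pi/2$. $P(\text{obtuse})$ is the probability that the triangle $P_1P_2P_3$ is obtuse, i.e. has some interior angle exceeding $\pi/2$. *)

(* Defs.v *)
From HB Require Import structures.
From mathcomp Require Import all_boot all_order all_algebra.
From mathcomp Require Import all_classical all_reals all_analysis.

Set Implicit Arguments.
Unset Strict Implicit.
Unset Printing Implicit Defensive.
Import Order.TTheory GRing.Theory Num.Theory.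
Import numFieldNormedType.Exports.

Local Open Scope classical_set_scope.
Local Open Scope ring_scope.

Section plane_geometry.
Context {R : realType}.
Implicit Types u v A B V : R * R.

Definition dot u v : R := u.1 * v.1 + u.2 * v.2.

(* The norm that the library puts on R * R is the max norm, hence this one. *)
Definition enorm u : R := Num.sqrt (dot u u).

(* The value is meaningful only if A and B are both distinct from V. *)
Definition angle_at V A B : R :=
  acos (dot (A - V) (B - V) / (enorm (A - V) * enorm (B - V))).

End plane_geometry.

Section triangles.
Context {R : realType}.
Implicit Types (t : 'I_3 -> R * R) (k : 'I_3).

Definition nondegenerate_triangle t : Prop :=
  ~ exists a b c : R, (a, b) != 0 /\ forall k, a * (t k).1 + b * (t k).2 = c.

(* Indices are cyclic: the vertices other than t k are its successor and its
   predecessor modulo 3. *)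
Definition interior_angle t k : R :=
  angle_at (t k) (t (ordS k)) (t (ord_pred k)).

Definition obtuse_at t k : Prop :=
  nondegenerate_triangle t /\ pi / 2 < interior_angle t k.

Definition obtuse_triangle t : Prop :=
  nondegenerate_triangle t /\ exists k, pi / 2 < interior_angle t k.

End triangles.

Section uniform_on_circle.
Context {R : realType}.

Definition circle_point (r theta : R) : R * R := (r * cos theta, r * sin theta).

Lemma two_pi_gt0 : 0 < 2 * pi :> R.
Proof. by rewrite mulr_gt0 ?pi_gt0. Qed.

(* Normalized arc length on the circle of radius r about the origin: the law
   of circle_point r theta when theta is uniform on [0, 2 * pi]. *)
Definition uniform_circle (r : R) : set (R * R) -> \bar R :=
  pushforward (uniform_prob two_pi_gt0) (circle_point r).

End uniform_on_circle.

(* The law is prescribed on measurable sets only: a set function such as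
   uniform_circle r has no mathematical meaning on other sets. *)
Definition has_law d d' (T : measurableType d) (T' : measurableType d')
    (R : realType) (P : probability T R) (X : {RV P >-> T'})
    (mu : set T' -> \bar R) : Prop :=
  forall A : set T', measurable A -> distribution P X A = mu A.

Definition mutually_independent d d' (T : measurableType d)
    (T' : measurableType d') (R : realType) (P : probability T R)
    (I : finType) (X : I -> {RV P >-> T'}) : Prop :=
  forall (J : {set I}) (A : I -> set T'), (forall i, measurable (A i)) ->
    P [set w | forall i, i \in J -> A i (X i w)] =
    (\prod_(i in J) P (X i @^-1` A i))%E.

(* Main.v *)
Require Import Defs.
From mathcomp Require Import all_boot all_order all_algebra.
From mathcomp Require Import all_classical all_reals all_analysis.
From mathcomp Require Import measurable_realfun ring lra.
Import Order.TTheory GRing.Theory Num.Theory.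
Import numFieldNormedType.Exports.
Local Open Scope classical_set_scope.
Local Open Scope ring_scope.

(** The proof is an antipodal symmetry argument; apart from the invariance of
    the uniform law under the antipodal map and the negligibility of lines
    through the centre, no integral is computed.

    For a triangle t inscribed in a circle about the origin O, let x_k be the
    determinant of the two vertices other than t k, in cyclic order. As long as
    x_0, x_1 and x_2 are all nonzero, their signs decide everything. Writing V
    for t k and A, B for the other two vertices, V = a A + b B where a and b are
    the opposites of the quotients of the two other determinants by x_k; the
    triangle is nondegenerate with an obtuse angle at V exactly when a + b > 1,
    and, the three points being on one circle, exactly when a, b > 0, that is,
    when x_k has the sign opposite to that of the two other determinants
    (obtuse_angle_on_circle). If no x_k is the odd one out, then the three
    determinants have the same sign, and O is inside the triangle.

    Hence, up to a null event, exactly one of four events holds: one for each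
    possible odd determinant, and one where the three signs agree. Replacing t k
    by its antipode preserves x_k and negates the two other determinants, so it
    exchanges the event that x_k is odd with the event that all signs agree. As
    the points are independent and the uniform law on the circle is invariant
    under the antipodal map, this exchange preserves the joint law, hence these
    events have the same probability (centre_opposite_inside). So the four
    events all have probability 1/4, and the triangle is obtuse with probability
    3/4.

    The event x_k = 0 is null by Fubini: given a point u != 0, the line through
    O and u carries no mass (uniform_circle_line). *)

(** * Obtuse angles as polynomial inequalities *)

(** The determinant of two plane vectors, twice the signed area that they
    span with the origin. *)
Definition det2 {R : realType} (u v : R * R) : R := u.1 * v.2 - u.2 * v.1.

Lemma det2_collinear {R : realType} (A B V : R * R) :
  det2 (A - V) (B - V) = det2 A B + det2 B V + det2 V A.
Proof. by rewrite /det2 /=; ring. Qed.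

Lemma dot_det2_sqr {R : realType} (u v : R * R) :
  dot u v ^+ 2 + det2 u v ^+ 2 = dot u u * dot v v.
Proof. by rewrite /dot /det2; ring. Qed.

Lemma dot_ge0 {R : realType} (u : R * R) : 0 <= dot u u.
Proof. by rewrite /dot -!expr2 addr_ge0 ?sqr_ge0. Qed.

Lemma ord3_cases (j k : 'I_3) : [\/ j = k, j = ordS k | j = ord_pred k].
Proof.
have : [|| j == k, j == ordS k | j == ord_pred k].
  by move: j k; do 2![case=> [[|[|[|//]]] ?]].
by case/or3P=> /eqP; [constructor 1|constructor 2|constructor 3].
Qed.

Lemma ordSS_pred (k : 'I_3) : ordS (ordS k) = ord_pred k.
Proof. by apply/val_inj; case: k => [[|[|[|//]]] ?]. Qed.

Lemma ord_predpredS (k : 'I_3) : ord_pred (ord_pred k) = ordS k.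
Proof. by apply/val_inj; case: k => [[|[|[|//]]] ?]. Qed.

(** The vertices are collinear iff the two sides at some vertex, equivalently
    at any vertex, are parallel. *)
Lemma nondegenerate_triangleP {R : realType} (t : 'I_3 -> R * R) (k : 'I_3) :
  nondegenerate_triangle t <->
  det2 (t (ordS k) - t k) (t (ord_pred k) - t k) != 0.
Proof.
set A := t (ordS k); set B := t (ord_pred k); set V := t k; split.
  apply: contra_notN => /eqP D0.
  (* The common line is directed by a nonzero side at V, if there is one; if the
     three vertices coincide, any line through them will do. *)
  have [AV|AV] := eqVneq A V; last first.
    exists (V.2 - A.2), (A.1 - V.1), ((V.2 - A.2) * V.1 + (A.1 - V.1) * V.2).
    split.
      apply: contra_neq AV => -[/eqP]; rewrite subr_eq0 => /eqP e2 /eqP.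
      rewrite subr_eq0 => /eqP e1.
      by apply/pair_eqP; rewrite /pair_eq e1 e2 !eqxx.
    move: D0; rewrite /det2 /= => D0 j.
    have [->|->|->] := ord3_cases j k; rewrite -/A -/B -/V; lra.
  have [BV|BV] := eqVneq B V; last first.
    exists (V.2 - B.2), (B.1 - V.1), ((V.2 - B.2) * V.1 + (B.1 - V.1) * V.2).
    split.
      apply: contra_neq BV => -[/eqP]; rewrite subr_eq0 => /eqP e2 /eqP.
      rewrite subr_eq0 => /eqP e1.
      by apply/pair_eqP; rewrite /pair_eq e1 e2 !eqxx.
    move=> j; have [->|->|->] := ord3_cases j k; rewrite -/A -/B -/V ?AV; lra.
  exists 1, 0, V.1; split; first by apply/negP => /eqP[] /eqP; rewrite oner_eq0.
  move=> j; have [->|->|->] := ord3_cases j k; rewrite -/A -/B -/V ?AV ?BV; lra.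
move=> D0 [a] [b] [c] [ab0 h].
have := h k; have := h (ordS k); have := h (ord_pred k).
rewrite -/A -/B -/V => hB hA hV.
have a0 : a * det2 (A - V) (B - V) = 0.
  have uA : a * (A.1 - V.1) + b * (A.2 - V.2) = 0 by lra.
  have uB : a * (B.1 - V.1) + b * (B.2 - V.2) = 0 by lra.
  rewrite (_ : _ * _ = (a * (A.1 - V.1) + b * (A.2 - V.2)) * (B.2 - V.2)
    - (a * (B.1 - V.1) + b * (B.2 - V.2)) * (A.2 - V.2)).
    by rewrite uA uB; ring.
  by rewrite /det2 /=; ring.
have b0 : b * det2 (A - V) (B - V) = 0.
  have uA : a * (A.1 - V.1) + b * (A.2 - V.2) = 0 by lra.
  have uB : a * (B.1 - V.1) + b * (B.2 - V.2) = 0 by lra.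
  rewrite (_ : _ * _ = (a * (B.1 - V.1) + b * (B.2 - V.2)) * (A.1 - V.1)
    - (a * (A.1 - V.1) + b * (A.2 - V.2)) * (B.1 - V.1)).
    by rewrite uA uB; ring.
  by rewrite /det2 /=; ring.
move/eqP: a0; rewrite mulf_eq0 (negPf D0) orbF => /eqP a0.
move/eqP: b0; rewrite mulf_eq0 (negPf D0) orbF => /eqP b0.
by rewrite a0 b0 eqxx in ab0.
Qed.

Lemma acos_gt_pihalf {R : realType} (x : R) : -1 <= x <= 1 ->
  (pi / 2 < acos x) = (x < 0).
Proof.
move=> x1.
have c x' : -1 <= x' <= 1 -> acos x' \in `[0, pi].
  by move=> h; rewrite in_itv/= acos_ge0// acos_lepi.
rewrite -acos0 -ltr_cos; [|apply: c; lra|exact: c].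
by rewrite !acosK ?in_itv//=; lra.
Qed.

Lemma angle_at_obtuse {R : realType} (A B V : R * R) :
  det2 (A - V) (B - V) != 0 ->
  (pi / 2 < angle_at V A B) = (dot (A - V) (B - V) < 0).
Proof.
rewrite /angle_at /enorm; set u := A - V; set v := B - V => D0.
have D2 : 0 < det2 u v ^+ 2 by rewrite exprn_even_gt0.
have E := dot_det2_sqr u v; have d2 := sqr_ge0 (dot u v).
have uv : 0 < dot u u * dot v v by lra.
rewrite -sqrtrM ?dot_ge0//; set n := Num.sqrt _.
have n0 : 0 < n by rewrite sqrtr_gt0.
have nE : n ^+ 2 = dot u u * dot v v by rewrite sqr_sqrtr// ltW.
have dn : `|dot u v| <= n.
  rewrite -(ler_pXn2r (n := 2)) ?nnegrE ?normr_ge0 ?(ltW n0)//.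
  by rewrite real_normK ?num_real//; lra.
rewrite acos_gt_pihalf; first by rewrite pmulr_llt0 ?invr_gt0.
rewrite -ler_norml normrM (ger0_norm (x := n^-1)) ?invr_ge0 ?(ltW n0)//.
by rewrite ler_pdivrMr// mul1r.
Qed.

Lemma obtuse_atP {R : realType} (t : 'I_3 -> R * R) (k : 'I_3) :
  let u := t (ordS k) - t k in let v := t (ord_pred k) - t k in
  obtuse_at t k <-> det2 u v != 0 /\ dot u v < 0.
Proof.
split=> -[].
  move/(nondegenerate_triangleP t k) => D0.
  by rewrite /interior_angle angle_at_obtuse.
move=> D0 d; split; first exact/(nondegenerate_triangleP t k).
by rewrite /interior_angle angle_at_obtuse.
Qed.

(** The heart of the matter: for three points on a circle about the origin, no
    two of them on a line through it, the angle at V is obtuse iff V is a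
    positive combination of A and B. *)
Lemma obtuse_angle_on_circle {R : realType} (s : R) (A B V : R * R) :
  dot A A = s -> dot B B = s -> dot V V = s ->
  det2 A B != 0 -> det2 B V != 0 -> det2 V A != 0 ->
  (det2 (A - V) (B - V) != 0 /\ dot (A - V) (B - V) < 0) <->
  (det2 A B * det2 B V < 0 /\ det2 A B * det2 V A < 0).
Proof.
move=> AA BB VV X0 Y0 Z0.
(* Cramer's rule: V = a A + b B. *)
pose a : R := - det2 B V / det2 A B; pose b : R := - det2 V A / det2 A B.
have VE : V = (a * A.1 + b * B.1, a * A.2 + b * B.2).
  rewrite [LHS]surjective_pairing /a /b; congr (_, _).
    by move: X0; rewrite /det2 => X0; field.
  by move: X0; rewrite /det2 => X0; field.
have DE : det2 (A - V) (B - V) = det2 A B * (1 - (a + b)).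
  by rewrite det2_collinear /a /b; field.
have YE : det2 A B * det2 B V = - (a * det2 A B ^+ 2) by rewrite /a; field.
have ZE : det2 A B * det2 V A = - (b * det2 A B ^+ 2) by rewrite /b; field.
clearbody a b.
set c := dot A B; have c2 : det2 A B ^+ 2 = s ^+ 2 - c ^+ 2.
  have := dot_det2_sqr A B; rewrite AA BB -/c; lra.
have X2 : 0 < det2 A B ^+ 2 by rewrite exprn_even_gt0.
have s0 : 0 <= s by rewrite -AA dot_ge0.
have [cs1 cs2] : 0 < s + c /\ 0 < s - c by split; nra.
(* dot V V = s, expanded in terms of a and b. *)
have sE : s * ((a + b) ^+ 2 - 1) = 2 * (a * b) * (s - c).
  have : s = s * a ^+ 2 + s * b ^+ 2 + 2 * a * b * c.
    by rewrite -[LHS]VV -{1}AA -BB VE /c /dot /=; ring.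
  lra.
have dE : dot (A - V) (B - V) = (s + c) * (1 - (a + b)).
  rewrite (_ : dot _ _ = c - dot A V - dot B V + s); last first.
    by rewrite -VV /c /dot /=; ring.
  have -> : dot A V = a * s + b * c by rewrite -AA {1}VE /c /dot/=; ring.
  have -> : dot B V = a * c + b * s by rewrite -BB {1}VE /c /dot/=; ring.
  ring.
rewrite dE DE YE ZE !oppr_lt0 pmulr_rlt0// !(pmulr_lgt0 _ X2) subr_lt0.
have {}s0 : 0 < s by lra.
split.
  move=> [_ ab]; have ab0 : 0 < a * b.
    have : 0 < s * ((a + b) ^+ 2 - 1) by rewrite mulr_gt0//; nra.
    by rewrite sE pmulr_lgt0// pmulr_rgt0.
  by split; nra.
move=> [a0 b0]; have ab : 1 < a + b.
  have : 0 < s * ((a + b) ^+ 2 - 1) by rewrite sE !mulr_gt0.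
  by rewrite pmulr_rgt0// => ?; nra.
by split => //; rewrite mulf_neq0// lt_eqF// subr_lt0.
Qed.

(** * Measurability of polynomial events in the plane *)

Section measurability.
Context {R : realType} d (T : measurableType d).
Implicit Types (f g : T -> R * R) (h : T -> R).

Lemma measurable_fun_det2 f g :
  measurable_fun setT f -> measurable_fun setT g ->
  measurable_fun setT (fun x => det2 (f x) (g x)).
Proof.
move=> mf mg; apply: measurable_funB; apply: measurable_funM;
  by apply: measurableT_comp => //.
Qed.

Lemma measurable_fun_dot f g :
  measurable_fun setT f -> measurable_fun setT g ->
  measurable_fun setT (fun x => dot (f x) (g x)).
Proof.
move=> mf mg; apply: measurable_funD; apply: measurable_funM;
  by apply: measurableT_comp => //.
Qed.

Lemma measurable_fun_addp f g :
  measurable_fun setT f -> measurable_fun setT g ->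
  measurable_fun setT (fun x => f x + g x).
Proof.
move=> mf mg; apply: measurable_fun_pair; apply: measurable_funD;
  by apply: measurableT_comp => //.
Qed.

Lemma measurable_fun_oppp f : measurable_fun setT f ->
  measurable_fun setT (fun x => - f x).
Proof.
move=> mf; apply: measurable_fun_pair; apply: measurableT_comp => //;
  by apply: measurableT_comp => //.
Qed.

Lemma measurable_lt0 h : measurable_fun setT h -> measurable [set x | h x < 0].
Proof.
move=> mh; rewrite (_ : [set _ | _] = h @^-1` `]-oo, 0[%classic).
  by rewrite -[X in measurable X]setTI; apply: mh.
by apply/seteqP; split=> x /=; rewrite in_itv.
Qed.

Lemma measurable_gt0 h : measurable_fun setT h -> measurable [set x | 0 < h x].
Proof.
move=> mh; rewrite (_ : [set _ | _] = [set x | (\- h) x < 0]).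
  by apply: measurable_lt0; exact: measurable_funN.
by apply/seteqP; split=> x /=; rewrite oppr_lt0.
Qed.

Lemma measurable_eqr h c :
  measurable_fun setT h -> measurable [set x | h x = c].
Proof.
move=> mh; rewrite (_ : [set _ | _] = h @^-1` [set c])//.
by rewrite -[X in measurable X]setTI; apply: mh.
Qed.

Lemma measurable_neqr h c :
  measurable_fun setT h -> measurable [set x | h x != c].
Proof.
move=> mh; rewrite (_ : [set _ | _] = ~` [set x | h x = c]).
  by apply: measurableC; exact: measurable_eqr.
by apply/seteqP; split=> x /= /eqP.
Qed.

End measurability.

Lemma measurable_preimage_oppp {R : realType} (A : set (R * R)) :
  measurable A -> measurable (-%R @^-1` A).
Proof.
by move=> mA; rewrite -[Y in measurable Y]setTI; exact: measurable_fun_oppp.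
Qed.

(** * The uniform law on the circle *)

Lemma lebesgue_measure_translation {R : realType} (c : R) (A : set R) :
  measurable A ->
  pushforward (@lebesgue_measure R)
    ((fun x => x + c) : _ -> measurableTypeR R) A = lebesgue_measure A.
Proof.
move=> mA; apply/esym/lebesgue_measure_unique => //=.
  exact: measurable_funD.
move=> mf _ [[a b]] _ <-; rewrite /pushforward.
rewrite (_ : _ @^-1` _ = `]a - c, b - c]%classic).
  rewrite !lebesgue_measure_itv/= !lte_fin ltrD2r; case: ifP => // _.
  by congr (_%:E); ring.
by apply/seteqP; split=> x /=; rewrite !in_itv/= ltrBlDr lerBrDr.
Qed.

(** The uniform law as normalized Lebesgue measure; the interval is taken
    half-open so that two halves of a period are translates of each other. *)
Lemma uniform_probE {R : realType} (a b : R) (ab : a < b) (U : set R) :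
  measurable U ->
  uniform_prob ab U =
  ((b - a)^-1%:E * lebesgue_measure (U `&` `[a, b[%classic))%E.
Proof.
move=> mU; rewrite /uniform_prob integral_uniform_pdf.
rewrite (eq_integral (fun=> (b - a)^-1%:E)); last first.
  by move=> x; rewrite inE/= in_itv/= /uniform_pdf => -[_ ->].
rewrite integral_cst/=; last exact: measurableI.
congr (_ * _)%E; rewrite -(setUitv1 true) ?bnd_simp ?ltW// setIUr.
apply: measureU0; [exact: measurableI|exact: measurableI|].
apply: (@subset_measure0 _ (measurableTypeR R) R lebesgue_measure _ [set b]).
- exact: measurableI.
- exact: measurable_set1.
- exact: subIsetr.
- exact: lebesgue_measure_set1.
Qed.

Lemma circle_pointDpi {R : realType} (r theta : R) :
  circle_point r (theta + pi) = - circle_point r theta.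
Proof. by rewrite /circle_point cosDpi sinDpi !mulrN. Qed.

Lemma circle_pointBpi {R : realType} (r theta : R) :
  circle_point r (theta - pi) = - circle_point r theta.
Proof. by rewrite -[in RHS](subrK pi theta) circle_pointDpi opprK. Qed.

Lemma measurable_circle_point {R : realType} (r : R) :
  measurable_fun [set: R] (circle_point r).
Proof.
apply: measurable_fun_pair; apply: measurable_funM => //=.
  exact: continuous_measurable_fun (@continuous_cos R).
exact: continuous_measurable_fun (@continuous_sin R).
Qed.

(** The antipodal map is a translation of the angle by a half-period, which
    exchanges the two halves of the period. *)
Lemma uniform_circle_opp {R : realType} (r : R) (A : set (R * R)) :
  measurable A -> uniform_circle r (-%R @^-1` A) = uniform_circle r A.
Proof.
move=> mA; have mNA := measurable_preimage_oppp A mA.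
rewrite /uniform_circle /pushforward.
have mC B : measurable B -> measurable (circle_point r @^-1` B).
  move=> mB; rewrite -[X in measurable X]setTI.
  exact: measurable_circle_point.
rewrite !uniform_probE; [|exact: mC..]; congr (_ * _)%E.
set U := circle_point r @^-1` A; set V := _ @^-1` (_ @^-1` A).
have mU : measurable U by exact: mC.
have mV : measurable V by exact: mC.
have pi0 := @pi_gt0 R.
pose I1 : set R := `[0, pi[%classic; pose I2 : set R := `[pi, 2 * pi[%classic.
have mI1 : measurable I1 by exact: measurable_itv.
have mI2 : measurable I2 by exact: measurable_itv.
have spl : `[0, 2 * pi[%classic = I1 `|` I2.
  apply/seteqP; split=> x; rewrite /I1 /I2 /= !in_itv/=.
    by move=> /andP[x0 x2]; have [xp|xp] := ltP x pi; [left; lra|right; lra].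
  by case=> /andP[]; lra.
have half (W : set R) : measurable W ->
    (lebesgue_measure (W `&` (I1 `|` I2)) =
     lebesgue_measure (W `&` I1) + lebesgue_measure (W `&` I2))%E.
  move=> mW; rewrite setIUr measureU//; try exact: measurableI.
  apply/seteqP; split=> // x [[_ h1] [_ h2]].
  by move: h1 h2; rewrite /I1 /I2 /= !in_itv/=; lra.
rewrite spl !half// addeC; congr (_ + _)%E.
  rewrite -[LHS](@lebesgue_measure_translation _ pi); last exact: measurableI.
  congr (lebesgue_measure _); apply/seteqP; split=> x /=;
    rewrite /U /V /I1 /I2 /= circle_pointDpi opprK !in_itv/=;
    by move=> -[? ?]; split=> //; lra.
rewrite -[LHS](@lebesgue_measure_translation _ (- pi)); last exact: measurableI.
congr (lebesgue_measure _); apply/seteqP; split=> x /=;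
  rewrite /U /V /I1 /I2 /= circle_pointBpi opprK !in_itv/=;
  by move=> -[? ?]; split=> //; lra.
Qed.

Lemma sin_eq0_small {R : realType} (x : R) : `|x| < pi -> sin x = 0 -> x = 0.
Proof.
rewrite ltr_norml => /andP[x1 x2] sx; have [x0|x0|//] := ltgtP x 0.
- have : 0 < sin (- x) by apply: sin_gt0_pi; lra.
  by rewrite sinN sx oppr0 ltxx.
- have : 0 < sin x by apply: sin_gt0_pi; lra.
  by rewrite sx ltxx.
Qed.

(** A line through the centre carries no mass. *)
Lemma uniform_circle_line {R : realType} (r : R) (u : R * R) :
  0 < r -> u != 0 -> uniform_circle r [set v | det2 u v = 0] = 0%E.
Proof.
move=> r0 u0; have mL : measurable [set v | det2 u v = 0].
  by apply: measurable_eqr; exact: measurable_fun_det2.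
rewrite /uniform_circle /pushforward.
have mZ : measurable (circle_point r @^-1` [set v | det2 u v = 0]).
  by rewrite -[X in measurable X]setTI; exact: measurable_circle_point.
rewrite uniform_probE//; set Z := _ @^-1` _.
(* Two angles on the line differ by a multiple of pi, so each half-period
   contains at most one of them. *)
have Z_inj x y : Z x -> Z y -> `|x - y| < pi -> x = y.
  rewrite /Z /det2 /= => zx zy xy; apply/eqP; rewrite -subr_eq0; apply/eqP.
  apply: sin_eq0_small => //; rewrite sinB.
  have rn0 : r != 0 by rewrite gt_eqF.
  have hx : u.1 * sin x = u.2 * cos x.
    by apply: (mulfI rn0); lra.
  have hy : u.1 * sin y = u.2 * cos y.
    by apply: (mulfI rn0); lra.
  have [u1|u1] := eqVneq u.1 0.
    have u2 : u.2 != 0.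
      by apply: contraNneq u0 => u2; rewrite [u]surjective_pairing u1 u2.
    apply: (mulfI u2); rewrite mulr0.
    transitivity (sin x * (u.2 * cos y) - sin y * (u.2 * cos x)); first by ring.
    by rewrite -hx -hy; ring.
  apply: (mulfI u1); rewrite mulr0.
  transitivity (u.1 * sin x * cos y - u.1 * sin y * cos x); first by ring.
  by rewrite hx hy; ring.
have pi0 := @pi_gt0 R.
have cZ (a : R) : countable (Z `&` `[a, a + pi[%classic).
  have [->|/set0P[z [Zz zi]]] := eqVneq (Z `&` `[a, a + pi[%classic) set0.
    exact: countable0.
  apply: (@sub_countable _ _ _ [set z]); last exact: countable1.
  apply: subset_card_le => x [Zx xi]; apply: Z_inj => //.
  by move: zi xi; rewrite /= !in_itv/= ltr_norml; lra.
rewrite (_ : Z `&` _ = (Z `&` `[0, 0 + pi[) `|` (Z `&` `[pi, pi + pi[)).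
  rewrite null_set_setU ?mule0//; try exact: measurableI;
    by apply: countable_lebesgue_measure0; exact: cZ.
apply/seteqP; split=> x /=; rewrite !in_itv/=.
  by move=> [Zx xi]; have [xp|xp] := ltP x pi; [left|right]; split=> //; lra.
by case=> -[Zx xi]; split=> //; lra.
Qed.

(** * Uniqueness of joint laws *)

(** A finite measure on a product is determined by its values on rectangles. *)
Lemma measure_prod_unique d1 d2 (T1 : measurableType d1)
    (T2 : measurableType d2) (R : realType)
    (m1 m2 : {measure set (T1 * T2) -> \bar R}) :
  (m1 setT < +oo)%E ->
  (forall A B, measurable A -> measurable B -> m1 (A `*` B) = m2 (A `*` B)) ->
  forall E, measurable E -> m1 E = m2 E.
Proof.
move=> m1oo m12.
apply: (measure_unique [set A `*` B | A in measurable & B in measurable]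
  (fun=> setT)) => //.
- exact: measurable_prod_measurableType.
- move=> _ _ [A1 mA1 [B1 mB1 <-]] [A2 mA2 [B2 mB2 <-]]; rewrite -setXI.
  by exists (A1 `&` A2); [exact: measurableI|];
    exists (B1 `&` B2) => //; exact: measurableI.
- by move=> _; exists setT => //; exists setT => //; rewrite setXTT.
- by rewrite bigcup_const.
- by move=> _ [A mA [B mB <-]]; exact: m12.
Qed.

Section joint_laws.
Context {d} {Omega : measurableType d} {R : realType} {P : probability Omega R}.

(** The events C and D carry the additional coordinates along when passing from
    two to three random elements. *)
Lemma joint_law_unique d1 d2 (T1 : measurableType d1) (T2 : measurableType d2)
    (f g : Omega -> T1 * T2) (C D : set Omega) :
  measurable_fun setT f -> measurable_fun setT g ->
  measurable C -> measurable D ->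
  (forall A B, measurable A -> measurable B ->
    P (f @^-1` (A `*` B) `&` C) = P (g @^-1` (A `*` B) `&` D)) ->
  forall E, measurable E -> P (f @^-1` E `&` C) = P (g @^-1` E `&` D).
Proof.
move=> mf mg mC mD fg E mE.
have := @measure_prod_unique _ _ T1 T2 R (pushforward (mrestr P mC) f)
  (pushforward (mrestr P mD) g).
apply => //.
by rewrite /= /pushforward /mrestr preimage_setT setTI ltey_eq fin_num_measure.
Qed.

Lemma joint_law3_unique d1 d2 d3 (T1 : measurableType d1)
    (T2 : measurableType d2) (T3 : measurableType d3)
    (f1 g1 : Omega -> T1) (f2 g2 : Omega -> T2) (f3 g3 : Omega -> T3) :
  measurable_fun setT f1 -> measurable_fun setT g1 ->
  measurable_fun setT f2 -> measurable_fun setT g2 ->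
  measurable_fun setT f3 -> measurable_fun setT g3 ->
  (forall A B C, measurable A -> measurable B -> measurable C ->
    P [set w | [/\ A (f1 w), B (f2 w) & C (f3 w)]] =
    P [set w | [/\ A (g1 w), B (g2 w) & C (g3 w)]]) ->
  forall E, measurable E ->
  P [set w | E (f1 w, f2 w, f3 w)] = P [set w | E (g1 w, g2 w, g3 w)].
Proof.
move=> mf1 mg1 mf2 mg2 mf3 mg3 fg E mE.
pose f12 w := (f1 w, f2 w); pose g12 w := (g1 w, g2 w).
have mf12 : measurable_fun setT f12 by exact: measurable_fun_pair.
have mg12 : measurable_fun setT g12 by exact: measurable_fun_pair.
have := @joint_law_unique _ _ _ _ (fun w => (f12 w, f3 w))
  (fun w => (g12 w, g3 w)) setT setT.
rewrite -[X in P X = _]setIT -[X in _ = P X]setIT.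
apply => //; try exact: measurable_fun_pair.
move=> A B mA mB; rewrite !setIT.
have mf3B : measurable (f3 @^-1` B).
  by rewrite -[X in measurable X]setTI; exact: mf3.
have mg3B : measurable (g3 @^-1` B).
  by rewrite -[X in measurable X]setTI; exact: mg3.
apply: (@joint_law_unique _ _ _ _ f12 g12 (f3 @^-1` B) (g3 @^-1` B)) => //.
move=> A1 A2 mA1 mA2; have := fg _ _ _ mA1 mA2 mB.
have H h1 h2 h3 : [set w | [/\ A1 (h1 w), A2 (h2 w) & B (h3 w)]] =
    (fun w => (h1 w, h2 w)) @^-1` (A1 `*` A2) `&` h3 @^-1` B :> set Omega.
  by apply/seteqP; split=> w /= => [[]|[[]]].
by rewrite !H.
Qed.

(** Events that agree outside a null event have the same probability. *)
Lemma probability_ext_null {N A B : set Omega} :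
  measurable N -> measurable A -> measurable B -> P N = 0%E ->
  (forall w, ~ N w -> (A w <-> B w)) -> P A = P B.
Proof.
move=> mN mA mB N0 AB.
have H (C : set Omega) : measurable C -> P C = P (C `\` N).
  move=> mC; rewrite measureD//; last by rewrite ltey_eq fin_num_measure.
  rewrite [X in (_ - X)%E](_ : _ = 0%E) ?sube0//.
  apply: (subset_measure0 _ mN) => //; exact: measurableI.
rewrite H// [RHS]H//; congr (P _).
by apply/seteqP; split=> w [? Nw]; split=> //; apply/(AB _ Nw).
Qed.

End joint_laws.

(** * Signs of the determinants of an inscribed triangle *)

(** The determinant of the two vertices other than t k, in cyclic order. *)
Definition opposite_det {R : realType} (t : 'I_3 -> R * R) (k : 'I_3) : R :=
  det2 (t (ordS k)) (t (ord_pred k)).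

(** The determinant opposite to t k has the sign opposite to that of the two
    others: the origin and t k are strictly on opposite sides of the line
    through the two other vertices, when t is inscribed in a circle about the
    origin. *)
Definition centre_opposite {R : realType} (t : 'I_3 -> R * R) (k : 'I_3) :
    Prop :=
  opposite_det t k * opposite_det t (ordS k) < 0 /\
  opposite_det t k * opposite_det t (ord_pred k) < 0.

(** The three determinants have the same sign, i.e., the origin is inside the
    triangle. This does not depend on k (centre_inside_ordS); k is kept to
    mirror the definition of centre_opposite. *)
Definition centre_inside {R : realType} (t : 'I_3 -> R * R) (k : 'I_3) :
    Prop :=
  0 < opposite_det t k * opposite_det t (ordS k) /\
  0 < opposite_det t k * opposite_det t (ord_pred k).

Lemma obtuse_at_centre_opposite {R : realType} (s : R) (t : 'I_3 -> R * R) :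
  (forall k, dot (t k) (t k) = s) -> (forall k, opposite_det t k != 0) ->
  forall k, obtuse_at t k <-> centre_opposite t k.
Proof.
move=> ts t0 k; rewrite /centre_opposite.
have t1 := t0 k; have t2 := t0 (ordS k); have t3 := t0 (ord_pred k).
move: t1 t2 t3; rewrite /opposite_det ordSK ord_predK ordSS_pred ord_predpredS.
move=> t1 t2 t3; apply: (iff_trans (obtuse_atP t k)).
exact: obtuse_angle_on_circle _ _ _ _ (ts _) (ts _) (ts _) _ _ _.
Qed.

Lemma centre_inside_ordS {R : realType} (t : 'I_3 -> R * R) k :
  centre_inside t (ordS k) <-> centre_inside t k.
Proof.
rewrite /centre_inside ordSK ordSS_pred.
set x := opposite_det t k; set y := opposite_det t _; set z := opposite_det t _.
by split=> -[h1 h2]; split; nra.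
Qed.

Lemma centre_opposite_disjoint {R : realType} (t : 'I_3 -> R * R) k :
  centre_opposite t k -> centre_opposite t (ordS k) -> False.
Proof.
rewrite /centre_opposite ordSK ordSS_pred.
set x := opposite_det t k; set y := opposite_det t _; set z := opposite_det t _.
by move=> [h1 h2] [h3 h4]; nra.
Qed.

Lemma centre_inside_opposite {R : realType} (t : 'I_3 -> R * R) k :
  centre_inside t k -> centre_opposite t k -> False.
Proof. by move=> [h _] [h' _]; move: (lt_trans h h'); rewrite ltxx. Qed.

Lemma centre_cases {R : realType} (t : 'I_3 -> R * R) k :
  (forall j, opposite_det t j != 0) ->
  [\/ centre_opposite t k, centre_opposite t (ordS k),
      centre_opposite t (ord_pred k) | centre_inside t k].
Proof.
move=> t0; have t1 := t0 k; have t2 := t0 (ordS k); have t3 := t0 (ord_pred k).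
move: t1 t2 t3; rewrite /centre_opposite /centre_inside.
rewrite ordSK ord_predK ordSS_pred ord_predpredS.
set x := opposite_det t k; set y := opposite_det t _; set z := opposite_det t _.
have neg (a b : R) : a * b != 0 -> 0 < a * b \/ a * b < 0.
  by move=> ab; have [|] := ltP 0 (a * b); [left|right; rewrite lt_neqAle ab].
move=> x0 y0 z0.
have [xy|xy] := neg x y (mulf_neq0 x0 y0);
  have [xz|xz] := neg x z (mulf_neq0 x0 z0).
- by constructor 4.
- by constructor 3; split; nra.
- by constructor 2; split; nra.
- by constructor 1.
Qed.

(** * Three independent uniform points on a circle *)

Section independent_points.
Context {R : realType} {d} {Omega : measurableType d} {P : probability Omega R}.
Context {r : R} {X : 'I_3 -> {RV P >-> (R * R)%type}}.
Context (r0 : 0 < r) (indX : mutually_independent X)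
  (lawX : forall k, has_law (X k) (uniform_circle r)).

Let mX k : measurable_fun setT (X k). Proof. exact: measurable_funPT. Qed.

Lemma law_opp k (A : set (R * R)) : measurable A ->
  P (X k @^-1` (-%R @^-1` A)) = P (X k @^-1` A).
Proof.
move=> mA; have := lawX k _ (measurable_preimage_oppp _ mA).
rewrite /distribution /pushforward => ->.
have := lawX k _ mA; rewrite /distribution /pushforward => ->.
exact: uniform_circle_opp.
Qed.

Lemma independent3 k (A B C : set (R * R)) :
  measurable A -> measurable B -> measurable C ->
  P [set w | [/\ A (X k w), B (X (ordS k) w) & C (X (ord_pred k) w)]] =
  (P (X k @^-1` A) * P (X (ordS k) @^-1` B) * P (X (ord_pred k) @^-1` C))%E.
Proof.
move=> mA mB mC.
have Sk : ordS k != k by clear; move: k; case=> [[|[|[|//]]] ?].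
have pk : ord_pred k != k by clear; move: k; case=> [[|[|[|//]]] ?].
have Sp : ord_pred k != ordS k by clear; move: k; case=> [[|[|[|//]]] ?].
pose D i := if i == k then A else if i == ordS k then B else C.
have Dk : D k = A by rewrite /D eqxx.
have DS : D (ordS k) = B by rewrite /D eqxx (negPf Sk).
have Dp : D (ord_pred k) = C by rewrite /D (negPf pk) (negPf Sp).
have mD i : measurable (D i) by rewrite /D; case: ifP => // _; case: ifP.
have := indX [set: 'I_3]%SET D mD.
rewrite (bigD1 k) ?finset.in_setT//= (bigD1 (ordS k))/= ?finset.in_setT//.
rewrite (bigD1 (ord_pred k))/= ?finset.in_setT ?pk ?Sp//.
rewrite big1 ?mule1; last first.
  move=> i /andP[/andP[/andP[_ ik] iS] ip].
  by have [/eqP|/eqP|/eqP] := ord3_cases i k;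
    rewrite (negPf ik, negPf iS, negPf ip).
rewrite Dk DS Dp muleA => <-; congr (P _); apply/seteqP; split=> w /=.
  move=> [Aw Bw Cw] i _.
  by have [->|->|->] := ord3_cases i k; rewrite ?Dk ?DS ?Dp.
by move=> h; split; [rewrite -Dk|rewrite -DS|rewrite -Dp]; apply: h;
  rewrite finset.in_setT.
Qed.

(** Replacing X k by its antipode exchanges the two events and preserves the
    joint law. *)
Lemma centre_opposite_inside k :
  P [set w | centre_opposite (X ^~ w) k] = P [set w | centre_inside (X ^~ w) k].
Proof.
pose S : set ((R * R) * (R * R) * (R * R)) :=
  [set z | det2 z.1.2 z.2 * det2 z.2 z.1.1 < 0] `&`
  [set z | det2 z.1.2 z.2 * det2 z.1.1 z.1.2 < 0].
have mS : measurable S.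
  have m1 : measurable_fun setT (fun z : (R * R) * (R * R) * (R * R) => z.1.1).
    exact: measurableT_comp.
  have m2 : measurable_fun setT (fun z : (R * R) * (R * R) * (R * R) => z.1.2).
    exact: measurableT_comp.
  have m3 : measurable_fun setT (fun z : (R * R) * (R * R) * (R * R) => z.2).
    exact: measurable_snd.
  by apply: measurableI; apply: measurable_lt0; apply: measurable_funM;
    exact: measurable_fun_det2.
rewrite (_ : [set w | centre_opposite _ k] =
    [set w | S (X k w, X (ordS k) w, X (ord_pred k) w)]); last first.
  apply/seteqP; split=> w; rewrite /S /centre_opposite /opposite_det /=;
    by rewrite ordSK ord_predK ordSS_pred ord_predpredS.
rewrite (_ : [set w | centre_inside _ k] =
    [set w | S (- X k w, X (ordS k) w, X (ord_pred k) w)]); last first.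
  have dN u v : det2 u (- v) = - det2 u v :> R by rewrite /det2 /=; ring.
  have Nd u v : det2 (- u) v = - det2 u v :> R by rewrite /det2 /=; ring.
  apply/seteqP; split=> w; rewrite /S /centre_inside /opposite_det /=;
    by rewrite ordSK ord_predK ordSS_pred ord_predpredS dN Nd !mulrN !oppr_lt0.
apply: joint_law3_unique => //; first exact: measurable_fun_oppp.
move=> A B C mA mB mC; rewrite independent3//.
have := independent3 k _ _ _ (measurable_preimage_oppp _ mA) mB mC.
by rewrite law_opp// => <-.
Qed.

Lemma on_circle k : P [set w | dot (X k w) (X k w) != r ^+ 2] = 0%E.
Proof.
have mN : measurable [set v : R * R | dot v v != r ^+ 2].
  by apply: measurable_neqr; exact: measurable_fun_dot.
have := lawX k _ mN; rewrite /distribution /pushforward => ->.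
rewrite /uniform_circle /pushforward (_ : _ @^-1` _ = set0) ?measure0//.
apply/seteqP; split=> // theta /= /eqP; apply.
rewrite /dot /circle_point /= -(mulr1 (r ^+ 2)) -(cos2Dsin2 theta); ring.
Qed.

(** By Fubini: almost surely X k is on the circle, hence nonzero, and the line
    through the origin and X k is null for the law of X (ordS k). *)
Lemma opposite_det_eq0_null k :
  P [set w | opposite_det (X ^~ w) (ord_pred k) = 0] = 0%E.
Proof.
rewrite /opposite_det ord_predK ord_predpredS.
pose S : set ((R * R) * (R * R)) :=
  [set z | dot z.1 z.1 = r ^+ 2] `&` [set z | det2 z.1 z.2 = 0].
have mS : measurable S.
  apply: measurableI; apply: measurable_eqr.
    exact: measurable_fun_dot.
  exact: measurable_fun_det2.
pose pairX w := (X k w, X (ordS k) w).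
have mpair : measurable_fun setT pairX by exact: measurable_fun_pair.
have S0 : P (pairX @^-1` S) = 0%E.
  transitivity ((distribution P (X k) \x distribution P (X (ordS k)))%E S).
    apply/esym.
    apply: (@product_measure_unique _ _ _ _ R _ _ (pushforward P pairX)) => //.
    move=> A B mA mB; rewrite /= /distribution /pushforward.
    have := independent3 k _ _ _ mA mB measurableT.
    rewrite preimage_setT probability_setT mule1 => <-.
    by congr (P _); apply/seteqP; split=> w /= => [[]|[]].
  rewrite /product_measure1; apply: integral0_eq => u _ /=.
  have [su|su] := eqVneq (dot u u) (r ^+ 2); last first.
    rewrite (_ : xsection S u = set0) ?measure0//.
    apply/seteqP; split=> // v; rewrite /xsection /= inE => -[/= /eqP].
    by rewrite (negPf su).
  rewrite (_ : xsection S u = [set v | det2 u v = 0]); last first.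
    by apply/seteqP; split=> v; rewrite /xsection /= inE => // -[].
  rewrite lawX; last by apply: measurable_eqr; exact: measurable_fun_det2.
  rewrite uniform_circle_line//.
  apply: contra_eq_neq su => ->; rewrite /dot /= !mulr0 addr0 eq_sym.
  by rewrite expf_neq0// gt_eqF.
have mD : measurable [set w | det2 (X k w) (X (ordS k) w) = 0].
  by apply: measurable_eqr; exact: measurable_fun_det2.
have mS' : measurable (pairX @^-1` S).
  by rewrite -[Y in measurable Y]setTI; exact: mpair.
rewrite -S0; apply: (probability_ext_null _ _ _ (on_circle k)) => //.
  by apply: measurable_neqr; exact: measurable_fun_dot.
move=> w /= /negP; rewrite negbK => /eqP su.
by split=> [|[]].
Qed.

Let x_ k w := opposite_det (X ^~ w) k.

Let mdet k : measurable_fun setT (x_ k).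
Proof. exact: measurable_fun_det2. Qed.

Let mEE k : measurable [set w | centre_opposite (X ^~ w) k].
Proof.
rewrite (_ : mkset _ = [set w | x_ k w * x_ (ordS k) w < 0] `&`
  [set w | x_ k w * x_ (ord_pred k) w < 0])//.
by apply: measurableI; apply: measurable_lt0; apply: measurable_funM.
Qed.

Let mII k : measurable [set w | centre_inside (X ^~ w) k].
Proof.
rewrite (_ : mkset _ = [set w | 0 < x_ k w * x_ (ordS k) w] `&`
  [set w | 0 < x_ k w * x_ (ord_pred k) w])//.
by apply: measurableI; apply: measurable_gt0; apply: measurable_funM.
Qed.

(* Almost surely the three points are on the circle and no two of them are on
   a line through the origin; degenerate is the exceptional event. *)
Let degenerate_at k : set Omega :=
  [set w | dot (X k w) (X k w) != r ^+ 2] `|` [set w | x_ k w = 0].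

Let mdegenerate_at k : measurable (degenerate_at k).
Proof.
apply: measurableU; last exact: measurable_eqr.
by apply: measurable_neqr; exact: measurable_fun_dot.
Qed.

Let degenerate : set Omega := degenerate_at ord0 `|`
  degenerate_at (ordS ord0) `|` degenerate_at (ord_pred ord0).

Let mdegenerate : measurable degenerate.
Proof. by apply: measurableU => //; apply: measurableU. Qed.

Let degenerate0 : P degenerate = 0%E.
Proof.
have N0 k : P (degenerate_at k) = 0%E.
  apply: null_set_setU; [|exact: measurable_eqr|exact: on_circle|].
    by apply: measurable_neqr; exact: measurable_fun_dot.
  by have := opposite_det_eq0_null (ordS k); rewrite ordSK.
have mN k := mdegenerate_at k.
have N01 := null_set_setU (mN ord0) (mN (ordS ord0)) (N0 _) (N0 _).
exact: (null_set_setU (measurableU _ _ (mN _) (mN _)) (mN _) N01 (N0 _)).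
Qed.

Let generic w : ~ degenerate w ->
  (forall k, dot (X k w) (X k w) = r ^+ 2) /\
  (forall k, opposite_det (X ^~ w) k != 0).
Proof.
move=> Dw; have nD k : ~ degenerate_at k w.
  move=> h; apply: Dw; move: h.
  by have [->|->|->] := ord3_cases k ord0 => h; [left; left|left; right|right].
split=> k.
  by apply/eqP; apply: contra_notT (nD k) => h; left.
by apply/negP => /eqP h; apply: (nD k); right.
Qed.

(* The common probability of the four events. *)
Let p := P [set w | centre_inside (X ^~ w) ord0].

Let pE k : P [set w | centre_opposite (X ^~ w) k] = p.
Proof.
have S j : P [set w | centre_inside (X ^~ w) (ordS j)] =
           P [set w | centre_inside (X ^~ w) j].
  by congr (P _); apply/seteqP; split=> w /= h;
    apply/(centre_inside_ordS (X ^~ w)).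
rewrite centre_opposite_inside /p.
have [->|->|->] := ord3_cases k ord0; [by []|exact: S|].
by rewrite -[in RHS](ord_predK ord0) S.
Qed.

Let some_opposite : set Omega :=
  [set w | exists k, centre_opposite (X ^~ w) k].

Let some_oppositeE k : some_opposite =
  [set w | centre_opposite (X ^~ w) k] `|`
  [set w | centre_opposite (X ^~ w) (ordS k)] `|`
  [set w | centre_opposite (X ^~ w) (ord_pred k)].
Proof.
apply/seteqP; split=> w /=; last first.
  by case=> [[]|] h; [exists k|exists (ordS k)|exists (ord_pred k)].
by move=> [j]; have [->|->|->] := ord3_cases j k => h;
  [left; left|left; right|right].
Qed.

Let P_some_opposite : P some_opposite = (p + p + p)%E.
Proof.
rewrite (some_oppositeE ord0) !measureU//=.
- by congr (_ + _ + _)%E; exact: pE.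
- by apply/seteqP; split=> // w /= [h /(centre_opposite_disjoint _ _ h)].
- exact: measurableU.
- apply/seteqP; split=> // w /= [[h1|h1] h2].
    by apply: (centre_opposite_disjoint _ _ h2); rewrite ord_predK.
  by apply: (centre_opposite_disjoint _ _ h1); rewrite ordSS_pred.
Qed.

Let msome_opposite : measurable some_opposite.
Proof.
rewrite (some_oppositeE ord0).
by apply: measurableU => //; apply: measurableU.
Qed.

Let p_quarter : p = (1 / 4)%:E.
Proof.
have pfin : p \is a fin_num by exact: fin_num_measure.
(* The three events centre_opposite and the event centre_inside are disjoint,
   and cover everything but the degenerate event. *)
have : (p + p + p + p = 1)%E.
  rewrite -P_some_opposite -measureU//; last first.
    apply/seteqP; split=> // w [[k ek]].
    have [E|E|E] := ord3_cases k ord0; move: ek; rewrite E => ek /= ik.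
    - exact: (centre_inside_opposite _ _ ik ek).
    - by apply: (centre_inside_opposite _ _ _ ek); apply/centre_inside_ordS.
    - apply: (centre_inside_opposite _ _ _ ek).
      by apply/centre_inside_ordS; rewrite ord_predK.
  rewrite -(probability_setT P).
  apply: (probability_ext_null mdegenerate) => //; first exact: measurableU.
  move=> w /generic[_ nz]; split=> // _.
  by have [h|h|h|h] := centre_cases _ ord0 nz;
    [left; eexists; exact: h..|right].
rewrite -(fineK pfin) -!EFinD => -[h]; congr (_%:E); lra.
Qed.

(* The points may leave the circle on a null event; the polynomial description
   of obtuseness holds there as well, so that the event is measurable. *)
Let mobtuse k : measurable [set w | obtuse_at (X ^~ w) k].
Proof.
rewrite (_ : [set w | _] =
    [set w | det2 (X (ordS k) w - X k w) (X (ord_pred k) w - X k w) != 0] `&`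
    [set w | dot (X (ordS k) w - X k w) (X (ord_pred k) w - X k w) < 0]);
  last first.
  by apply/seteqP; split=> w; have [h1 h2] := obtuse_atP (X ^~ w) k.
have mB i j : measurable_fun setT (fun w => X i w - X j w).
  by apply: measurable_fun_addp => //; exact: measurable_fun_oppp.
apply: measurableI; first by apply: measurable_neqr; exact: measurable_fun_det2.
by apply: measurable_lt0; exact: measurable_fun_dot.
Qed.

Lemma obtuse_at_probability k :
  P [set w | obtuse_at (X ^~ w) k] = (1 / 4)%:E.
Proof.
rewrite -p_quarter -(pE k); apply: (probability_ext_null mdegenerate) => //.
by move=> w /generic[on nz]; exact: (obtuse_at_centre_opposite _ _ on nz k).
Qed.

Lemma obtuse_triangle_probability :
  P [set w | obtuse_triangle (X ^~ w)] = (3 / 4)%:E.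
Proof.
have -> : [set w | obtuse_triangle (X ^~ w)] =
    \bigcup_(k in [set: 'I_3]) [set w | obtuse_at (X ^~ w) k].
  apply/seteqP; split=> w.
    by move=> [nd [k hk]]; exists k.
  by move=> [k _ [nd hk]]; split=> //; exists k.
transitivity (P some_opposite); last first.
  by rewrite P_some_opposite p_quarter -!EFinD; congr (_%:E); lra.
apply: (probability_ext_null mdegenerate) => //.
  by apply: fin_bigcup_measurable; first exact: finite_finset.
move=> w /generic[on nz]; have h := obtuse_at_centre_opposite _ _ on nz.
by split=> [[k _ /h]|[k /h]]; exists k.
Qed.

End independent_points.

Theorem corollary5p1 (R : realType) (d : measure_display)
    (Omega : measurableType d) (P : probability Omega R) (r : R)
    (X : 'I_3 -> {RV P >-> (R * R)%type}) :
  0 < r ->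
  mutually_independent X ->
  (forall k, has_law (X k) (uniform_circle r)) ->
  (forall k, P [set w | obtuse_at (fun i => X i w) k] = (1 / 4)%:E) /\
  P [set w | obtuse_triangle (fun i => X i w)] = (3 / 4)%:E.
Proof.
move=> r0 indX lawX; split.
  exact: obtuse_at_probability r0 indX lawX.
exact: obtuse_triangle_probability r0 indX lawX.
Qed.
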